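(* The polynomials $S_n^D(q)$ have the following generating functions: $$\sum_{n\ge1}S_{2n}^D(q)\frac{u^{2n}}{D_{2n}(1,q)}=\frac{-2\cos_q^2(u)+\cos_q(u)\big(\cos_D(u;q)-1\big)-2\sin_q^2(u)+\sin_q(u)\sin_D(u;q)}{-\cos_q(u)},$$ $$\sum_{n\ge1}S_{2n+1}^D(q)\frac{u^{2n+1}}{D_{2n+1}(1,q)}=\frac{-2\sin_q(u)+u\cos_q(u)+\sin_D(u;q)}{-\cos_q(u)}.$$
   Context: $\mathfrak{B}_n$ is the group of permutations $w$ of $\{\pm1,\dots,\pm n\}$ with $w(-i)=-w(i)$, written $w=w_1,\dots,w_n$ with $w_i=w(i)$; $\mathfrak{D}_n\subseteq\mathfrak{B}_n$ is the subgroup of those $w$ with an even number of negative entries among $w_1,\dots,w_n$. $\mathrm{inv}_D(w)=|\{1\le i<j\le n:w_i>w_j\}|+|\{1\le i<j\le n:-w_i>w_j\}|$ and $D_n(1,q)=\sum_{w\in\mathfrak{D}_n}q^{\mathrm{inv}_D(w)}$ (so $D_0(1,q)=D_1(1,q)=1$). A d-snake in $\mathfrak{D}_n$ is $w\in\mathfrak{D}_n$ with $-w_2>w_1>w_2<w_3>\cdots$ (alternating up to $w_n$), and $S_n^D(q)=\sum_wq^{\mathrm{inv}_D(w)}$, the sum over all d-snakes $w$ in $\mathfrak{D}_n$. $[j]_q=1+q+\cdots+q^{j-1}$, $[n]_q!=\prod_{j=1}^n[j]_q$, $\mathrm{e}_q(u)=\sum_{n\ge0}u^n/[n]_q!$,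 $\exp_D(u;q)=\sum_{n\ge0}u^n/D_n(1,q)$, and with $i^2=-1$: $\cos_q(u)=\frac{\mathrm{e}_q(iu)+\mathrm{e}_q(-iu)}2$, $\sin_q(u)=\frac{\mathrm{e}_q(iu)-\mathrm{e}_q(-iu)}{2i}$, $\cos_D(u;q)=\frac{\exp_D(iu;q)+\exp_D(-iu;q)}2$, $\sin_D(u;q)=\frac{\exp_D(iu;q)-\exp_D(-iu;q)}{2i}$.
   Formalization: In the first identity cos_D(u;q) − 1 is replaced by cos_D(u;q) + 1: as printed the right-hand side equals 2 at u = 0 while the left-hand side has no constant term; all other coefficients are as printed. *)

(* Defs.v *)
From HB Require Import structures.
From mathcomp Require Import all_boot all_order all_algebra all_fingroup all_field.
From mathcomp Require Import boolp.

Set Implicit Arguments.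
Unset Strict Implicit.
Unset Printing Implicit Defensive.

Import Order.TTheory GRing.Theory Num.Theory.
Local Open Scope ring_scope.

(* The generating functions are formal power series in u, with Cauchy         *)
(* product; no notion of convergence is involved.                             *)

Record fps (R : Type) := Fps { fcoef : nat -> R }.

Lemma fpsP (R : Type) (f g : fps R) : fcoef f =1 fcoef g <-> f = g.
Proof.
split=> [|-> //]; case: f g => f [g] /= fg.
by congr Fps; apply: funext.
Qed.

HB.instance Definition _ (R : Type) := gen_eqMixin (fps R).
HB.instance Definition _ (R : Type) := gen_choiceMixin (fps R).

Section FpsRing.
Variable R : comUnitRingType.
Implicit Types f g h : fps R.

Definition fps_zero : fps R := Fps (fun=> 0).
Definition fps_opp f : fps R := Fps (fun n => - fcoef f n).
Definition fps_add f g : fps R := Fps (fun n => fcoef f n + fcoef g n).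

Fact fps_addA : associative fps_add.
Proof. by move=> f g h; apply/fpsP => n /=; rewrite addrA. Qed.
Fact fps_addC : commutative fps_add.
Proof. by move=> f g; apply/fpsP => n /=; rewrite addrC. Qed.
Fact fps_add0 : left_id fps_zero fps_add.
Proof. by move=> f; apply/fpsP => n /=; rewrite add0r. Qed.
Fact fps_addN : left_inverse fps_zero fps_opp fps_add.
Proof. by move=> f; apply/fpsP => n /=; rewrite addNr. Qed.

HB.instance Definition _ :=
  GRing.isZmodule.Build (fps R) fps_addA fps_addC fps_add0 fps_addN.

Definition fpsC (c : R) : fps R := Fps (fun n => if n == 0%N then c else 0).
Definition fps_mul f g : fps R :=
  Fps (fun n => \sum_(i < n.+1) fcoef f i * fcoef g (n - i)).

(* The first n coefficients of a series, as a polynomial; it transports the   *)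
(* ring laws of {poly R} to series.                                           *)
Definition fps_trunc n f : {poly R} := \poly_(i < n) fcoef f i.

Fact fcoef_mulE f g n m : (n < m)%N ->
  fcoef (fps_mul f g) n = (fps_trunc m f * fps_trunc m g)`_n.
Proof.
move=> nm; rewrite coefM /=; apply: eq_bigr => i _.
have im : (i < m)%N by apply: leq_trans nm; rewrite ltn_ord.
by rewrite !coef_poly im (leq_ltn_trans (leq_subr _ _) nm).
Qed.

Fact fps_mulC : commutative fps_mul.
Proof.
by move=> f g; apply/fpsP => n; rewrite !(fcoef_mulE _ _ (ltnSn n)) mulrC.
Qed.

Fact fps_mulA : associative fps_mul.
Proof.
move=> f g h; apply/fpsP => n.
have trM (a b : fps R) (c : {poly R}) :
    (fps_trunc n.+1 (fps_mul a b) * c)`_n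
    = (fps_trunc n.+1 a * fps_trunc n.+1 b * c)`_n.
  rewrite !coefM; apply: eq_bigr => i _; congr (_ * _).
  by rewrite coef_poly ltn_ord (fcoef_mulE _ _ (ltn_ord i)).
rewrite !(fcoef_mulE _ _ (ltnSn n)) trM.
by rewrite [in LHS]mulrC trM [in LHS]mulrC mulrA.
Qed.

Fact fps_mul1 : left_id (fpsC 1) fps_mul.
Proof.
move=> f; apply/fpsP => n /=.
rewrite big_ord_recl /= mul1r subn0 big1 ?addr0 // => i _.
by rewrite mul0r.
Qed.

Fact fps_mulDl : left_distributive fps_mul fps_add.
Proof.
move=> f g h; apply/fpsP => n /=; rewrite -big_split /=.
by apply: eq_bigr => i _; rewrite mulrDl.
Qed.

Fact fps_1neq0 : fpsC 1 != 0.
Proof.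
apply/eqP => /(congr1 (fun f => fcoef f 0)) /= /eqP.
by rewrite oner_eq0.
Qed.

HB.instance Definition _ := GRing.Zmodule_isComNzRing.Build (fps R)
  fps_mulA fps_mulC fps_mul1 fps_mulDl fps_1neq0.

(* A series is invertible exactly when its constant term is.  With c the      *)
(* constant term of f, 1/f = sum_k c^-(k+1) (c - f)^k, and (c - f)^k has no   *)
(* term of degree < k, so only k <= n contributes to the coefficient of u^n.  *)
Definition fps_unit : {pred fps R} := fun f => fcoef f 0 \is a GRing.unit.
Definition fps_inv f : fps R :=
  if f \in fps_unit then
    Fps (fun n => \sum_(k < n.+1)
           (fcoef f 0)^-1 ^+ k.+1 * fcoef ((fpsC (fcoef f 0) - f) ^+ k) n)
  else f.

Fact fcoefD f g n : fcoef (f + g) n = fcoef f n + fcoef g n.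
Proof. by []. Qed.
Fact fcoefN f n : fcoef (- f) n = - fcoef f n.
Proof. by []. Qed.
Fact fcoefM f g n :
  fcoef (f * g) n = \sum_(i < n.+1) fcoef f i * fcoef g (n - i).
Proof. by []. Qed.

Fact fcoefCM c f n : fcoef (fpsC c * f) n = c * fcoef f n.
Proof.
rewrite fcoefM big_ord_recl /= subn0 big1 ?addr0 // => i _.
by rewrite mul0r.
Qed.

Fact fcoef_exp_small f k n : fcoef f 0 = 0 -> (n < k)%N -> fcoef (f ^+ k) n = 0.
Proof.
move=> f0; elim: k n => // k IHk n nk; rewrite exprS fcoefM.
apply: big1 => -[[|i] /= lti] _; first by rewrite f0 mul0r.
rewrite IHk ?mulr0 //; move: lti nk; rewrite !ltnS => lti nk.
by apply: leq_trans nk; case: n lti => // n _; rewrite subSS ltnS leq_subr.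
Qed.

Fact fps_mulVx : {in fps_unit, left_inverse 1 fps_inv *%R}.
Proof.
move=> f Uf; rewrite /fps_inv Uf mulrC; set c := fcoef f 0.
have Uc : c \is a GRing.unit by [].
set d := fpsC c - f; have d0 : fcoef d 0 = 0 by rewrite /d fcoefD fcoefN /= subrr.
have fE : f = fpsC c - d by rewrite /d opprB addrC subrK.
set g := Fps _.
(* Partial sums of length m agree with g in degrees below m. *)
pose G m : fps R := \sum_(k < m) fpsC (c^-1 ^+ k.+1) * d ^+ k.
have fcoef_sum m (F : 'I_m -> fps R) n :
    fcoef (\sum_(k < m) F k) n = \sum_(k < m) fcoef (F k) n.
  by elim/big_ind2: _ => // ? ? ? ? <- <-.
have Gg m n : (n < m)%N -> fcoef g n = fcoef (G m) n.
  move=> nm; rewrite /G fcoef_sum.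
  under [RHS]eq_bigr => k _ do rewrite fcoefCM.
  rewrite -(subnKC nm) big_split_ord /= [X in _ = _ + X]big1 ?addr0 // => k _.
  by rewrite fcoef_exp_small ?mulr0 // leq_addr.
have fpsCM a b : fpsC (a * b) = fpsC a * fpsC b.
  by apply/fpsP => n; rewrite fcoefCM /=; case: eqP; rewrite ?mulr0.
have tele m : f * G m = 1 - fpsC (c^-1 ^+ m) * d ^+ m.
  elim: m => [|m IHm]; first by rewrite /G big_ord0 mulr0 !expr0 mulr1 subrr.
  rewrite /G big_ord_recr mulrDr -/(G m) IHm /= {1}fE mulrBl mulrA -fpsCM.
  rewrite exprS mulrA divrr // mul1r [d * _]mulrCA -exprS -exprS.
  by rewrite addrA subrK.
apply/fpsP => n; rewrite fcoefM.
under eq_bigr => i _ do rewrite (Gg n.+1) ?ltnS ?leq_subr //.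
rewrite -fcoefM tele fcoefD fcoefN fcoefCM.
by rewrite (fcoef_exp_small d0 (ltnSn n)) mulr0 subr0.
Qed.

Fact fps_unitPl f g : g * f = 1 -> fps_unit f.
Proof.
move=> /(congr1 (fun h => fcoef h 0)); rewrite fcoefM big_ord1 /= => gf.
by apply/unitrPr; exists (fcoef g 0); rewrite mulrC.
Qed.

Fact fps_invr_out : {in [predC fps_unit], fps_inv =1 id}.
Proof. by move=> f; rewrite inE /= /fps_inv => /negPf ->. Qed.

HB.instance Definition _ := GRing.ComNzRing_hasMulInverse.Build (fps R)
  fps_mulVx fps_unitPl fps_invr_out.

Lemma fps_unitE f : (f \is a GRing.unit) = (fcoef f 0 \is a GRing.unit).
Proof. by []. Qed.

Lemma fps_natE n : n%:R = fpsC n%:R :> fps R.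
Proof.
elim: n => [|n IHn]; first by apply/fpsP => -[].
rewrite -!natr1 IHn; apply/fpsP => m; rewrite fcoefD.
by case: m => [|m] //=; rewrite addr0.
Qed.

Definition fpsX : fps R := Fps (fun n => (n == 1%N)%:R).

(* f(c u), for f = f(u) *)
Definition fps_dilate (c : R) f : fps R := Fps (fun n => c ^+ n * fcoef f n).

End FpsRing.

(* Signed permutations.  (b, k) : sidx n stands for k + 1 if b = false, and    *)
(* for -(k + 1) if b = true; positions i : 'I_n likewise stand for i + 1.     *)

Definition sidx (n : nat) : finType := (bool * 'I_n)%type.
Definition sidx_opp n (x : sidx n) : sidx n := (~~ x.1, x.2).
Definition sidx_val n (x : sidx n) : int := (-1) ^+ x.1 * (x.2.+1)%:Z.

Definition groupB n : {set {perm sidx n}} :=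
  [set w : {perm sidx n} | [forall x, w (sidx_opp x) == sidx_opp (w x)]].

Definition letter n (w : {perm sidx n}) (i : 'I_n) : int :=
  sidx_val (w (false, i)).

Definition groupD n : {set {perm sidx n}} :=
  [set w in groupB n | ~~ odd #|[set i | letter w i < 0]|].

Definition inversions n (w : {perm sidx n}) : {set 'I_n * 'I_n} :=
  [set p : 'I_n * 'I_n | (p.1 < p.2)%N && (letter w p.1 > letter w p.2)].

Definition neg_sum_pairs n (w : {perm sidx n}) : {set 'I_n * 'I_n} :=
  [set p : 'I_n * 'I_n | (p.1 < p.2)%N && (- letter w p.1 > letter w p.2)].

Definition invD n (w : {perm sidx n}) : nat :=
  (#|inversions w| + #|neg_sum_pairs w|)%N.

(* - w_2 > w_1 > w_2 < w_3 > ... ; an index i from 0 is the position i + 1,   *)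
(* so the descents are at the even i.                                         *)
Definition dsnake n (w : {perm sidx n}) : bool :=
  [forall i : 'I_n, forall j : 'I_n, (j == i.+1 :> nat) ==>
     [&& (i == 0%N :> nat) ==> (- letter w j > letter w i)
       & if odd i then letter w i < letter w j else letter w i > letter w j]].

(* Polynomials in q; here 'X is q. *)

Definition polyD1 n : {poly int} := \sum_(w in groupD n) 'X^(invD w).
Definition polyS n : {poly int} :=
  \sum_(w in groupD n | dsnake w) 'X^(invD w).
Definition qint j : {poly int} := \sum_(k < j) 'X^k.
Definition qfact n : {poly int} := \prod_(1 <= j < n.+1) qint j.

(* Series in u, over the field of rational functions in q with coefficients   *)
(* in the algebraic numbers (which contains the imaginary unit).              *)

Definition ratq : fieldType := {fraction {poly algC}}.
Definition ratq_of (p : {poly int}) : ratq := tofrac (map_poly intr p).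
Definition iq : ratq := tofrac ('i%:P : {poly algC}).

Definition e_q : fps ratq := Fps (fun n => (ratq_of (qfact n))^-1).
Definition exp_D : fps ratq := Fps (fun n => (ratq_of (polyD1 n))^-1).

Definition fps_cos (E : fps ratq) : fps ratq :=
  (fps_dilate iq E + fps_dilate (- iq) E) / 2.
Definition fps_sin (E : fps ratq) : fps ratq :=
  (fps_dilate iq E - fps_dilate (- iq) E) / fpsC (2 * iq).

Definition cos_q : fps ratq := fps_cos e_q.
Definition sin_q : fps ratq := fps_sin e_q.
Definition cos_D : fps ratq := fps_cos exp_D.
Definition sin_D : fps ratq := fps_sin exp_D.

Definition snake_coef n : ratq := ratq_of (polyS n) / ratq_of (polyD1 n).

Definition even_snake_series : fps ratq :=
  Fps (fun m => if (2 <= m)%N && ~~ odd m then snake_coef m else 0).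
Definition odd_snake_series : fps ratq :=
  Fps (fun m => if (3 <= m)%N && odd m then snake_coef m else 0).

(* The divisors used in these series are invertible, as is cos_q.             *)

Lemma ratq_of_neq0 (p : {poly int}) : p.[1%R] != 0 -> ratq_of p != 0.
Proof.
move=> p1; rewrite /ratq_of tofrac_eq0 map_poly_eq0_id0.
  by apply: contraNneq p1 => ->; rewrite horner0.
by rewrite intr_eq0 lead_coef_eq0; apply: contraNneq p1 => ->; rewrite horner0.
Qed.

Lemma polyD1_neq0 n : ratq_of (polyD1 n) != 0.
Proof.
apply: ratq_of_neq0; rewrite /polyD1 horner_sum.
under eq_bigr do rewrite hornerXn expr1n.
rewrite sumr_const pnatr_eq0 -lt0n; apply/card_gt0P; exists 1%g.
rewrite !inE; apply/andP; split; first by apply/forallP => x; rewrite !perm1.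
rewrite (_ : [set _ | _] = set0) ?cards0 //; apply/setP => i.
rewrite !inE /letter perm1 /sidx_val /=.
by rewrite expr0 mul1r.
Qed.

Lemma qfact_neq0 n : ratq_of (qfact n) != 0.
Proof.
apply: ratq_of_neq0; rewrite /qfact horner_prod prodf_seq_neq0; apply/allP => j.
rewrite mem_index_iota /= => /andP[j0 _]; rewrite /qint horner_sum.
under eq_bigr do rewrite hornerXn expr1n.
by rewrite sumr_const card_ord pnatr_eq0 -lt0n.
Qed.

Lemma two_neq0 : (2 : ratq) != 0.
Proof.
rewrite -[2]/(2%:R) -(rmorph_nat (@tofrac _)) tofrac_eq0.
by rewrite -polyC_natr polyC_eq0 pnatr_eq0.
Qed.

Lemma two_iq_unit : fpsC (2 * iq) \is a GRing.unit.
Proof.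
rewrite fps_unitE [fcoef _ _]/= unitfE; apply: mulf_neq0 two_neq0 _.
by rewrite tofrac_eq0 polyC_eq0 neq0Ci.
Qed.

Lemma cos_q_unit : cos_q \is a GRing.unit.
Proof.
have U2 : (2 : fps ratq) \is a GRing.unit.
  by rewrite fps_natE fps_unitE [fcoef _ _]/= unitfE two_neq0.
rewrite /cos_q /fps_cos unitrM unitrV U2 andbT fps_unitE fcoefD.
rewrite /fps_dilate [fcoef (Fps _) _]/= [fcoef (Fps _) _ in X in _ + X]/=.
rewrite !expr0 !mul1r unitfE -mulr2n -mulr_natr mulf_eq0 negb_or.
apply/andP; split; last exact: two_neq0.
by rewrite invr_eq0 qfact_neq0.
Qed.

(* Main.v *)
Require Import Defs.
From mathcomp Require Import all_boot all_order all_algebra all_fingroup all_field.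
From mathcomp Require Import zify ring boolp.
Import Order.TTheory GRing.Theory Num.Theory.
Local Open Scope ring_scope.

Set Implicit Arguments.
Unset Strict Implicit.

(** Write D_n for the sum of q^inv_D over the whole group, S_n for the sum over
    the snakes, and e_m = 1/[m]_q!; call the ratio to D_n of the weight of a set
    of words its frequency.

    The basic fact is a factorization over blocks.  In a word of length k + m,
    the words whose first k letters form a given pattern and whose last m
    letters increase have frequency (frequency of the pattern in length k) * e_m
    ([Dfreq_blocks]).  Indeed, let a signed permutation of the first k positions
    and a permutation of the last m ones act: of the inversions counted by
    inv_D, only those inside the two blocks change, and up to order isomorphism
    the two blocks run independently over all signed words of length k and all
    arrangements of m letters; it then suffices to average over this action.
    This argument lives in the full group of signed permutations.  The passage
    from there to the even ones costs a factor 2, because flipping the sign of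
    the letter of absolute value 1 alters no comparison ([Bsum_Dsum]).

    Let z_j be the frequency of the words that start like a snake up to position
    2j + 1 and increase from there on.  If a word starts with a snake of odd
    length 2j + 1 >= 3, increases after it, and nothing is said about the step
    between the two parts, then that step is either an ascent or a descent,
    so that
        S_(2j+1)/D_(2j+1) * e_(n-2j-1) = z_j + z_(j+1)
    ([partial_snake_step]).  The last z_j is S_n/D_n ([partial_snake_last]), and
    the first one is z_1 = e_(n-1) - 2 e_n + 1/D_n by inclusion-exclusion on the
    two descents at the start of a snake ([partial_snake_first]).  The
    alternating sum of these equations over j telescopes.  Its left-hand side is
    a coefficient of the product of the odd snake series with cos_q when n is
    odd, and with sin_q when n is even, whence
        odd * cos_q = 2 sin_q - u cos_q - sin_D,
        even = odd * sin_q + u sin_q + 2 cos_q - cos_D - 1,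
    and the theorem follows by solving for the two series. *)

(** * Words and their order types *)

Definition inv_word n (f : 'I_n -> int) : nat :=
  \sum_(i < n) \sum_(j < n | (i < j)%N) (f j < f i)%R.
Definition nsp_word n (f : 'I_n -> int) : nat :=
  \sum_(i < n) \sum_(j < n | (i < j)%N) (f j < - f i)%R.
Definition increasing n (f : 'I_n -> int) : bool :=
  [forall i : 'I_n, forall j : 'I_n, (i < j)%N ==> (f i < f j)].
(** The comparisons between distinct letters and their opposites are all that
    inv_D and the snake condition see.  The comparison of a letter with its own
    opposite is left out on purpose: the sign of the letter of least absolute
    value stays free. *)
Definition same_order n (f g : 'I_n -> int) : Prop :=
  forall i j, i != j ->
    (f i < f j) = (g i < g j) /\ (f i < - f j) = (g i < - g j).
Definition same_pattern n (f g : 'I_n -> int) : Prop :=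
  forall i j, (f i < f j) = (g i < g j).
Definition pattern_invariant T n (G : ('I_n -> int) -> T) : Prop :=
  forall f g, same_pattern f g -> G f = G g.
Definition order_invariant T n (G : ('I_n -> int) -> T) : Prop :=
  forall f g, same_order f g -> G f = G g.

Lemma card_pairs n (P : 'I_n -> 'I_n -> bool) :
  #|[set p : 'I_n * 'I_n | (p.1 < p.2)%N && P p.1 p.2]|
  = (\sum_(i < n) \sum_(j < n | (i < j)%N) P i j)%N.
Proof.
rewrite pair_big_dep /= -sum1dep_card big_mkcondr /=.
by apply: eq_bigr => p _; case: (P _ _).
Qed.

Lemma invDE n (w : {perm sidx n}) :
  invD w = (inv_word (letter w) + nsp_word (letter w))%N.
Proof.
congr (_ + _)%N.
  exact: (card_pairs (fun i j => letter w j < letter w i)).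
exact: (card_pairs (fun i j => letter w j < - letter w i)).
Qed.

Lemma same_order_pattern n (f g : 'I_n -> int) : same_order f g -> same_pattern f g.
Proof. by move=> fg i j; have [->|/fg[]//] := eqVneq i j; rewrite !ltxx. Qed.

Lemma inv_word_pattern n : pattern_invariant (@inv_word n).
Proof.
by move=> f g fg; apply: eq_bigr => i _; apply: eq_bigr => j _; rewrite fg.
Qed.

Lemma increasing_pattern n : pattern_invariant (@increasing n).
Proof. by move=> f g fg; do 2![apply: eq_forallb => ?]; rewrite fg. Qed.

Lemma nsp_word_invariant n : order_invariant (@nsp_word n).
Proof.
move=> f g fg; apply: eq_bigr => i _; apply: eq_bigr => j ij; congr nat_of_bool.
by have [] := fg j i; first by rewrite neq_ltn ij orbT.
Qed.

Definition snake_word n (f : 'I_n -> int) : bool :=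
  [forall i : 'I_n, forall j : 'I_n, (j == i.+1 :> nat) ==>
     [&& (i == 0%N :> nat) ==> (- f j > f i)
       & if odd i then f i < f j else f i > f j]].

Lemma snake_word_invariant n : order_invariant (@snake_word n).
Proof.
move=> f g fg; apply: eq_forallb => i; apply: eq_forallb => j.
case: eqP => //= ji.
have ij : i != j by rewrite -val_eqE /= ji neq_ltn ltnSn.
by have [-> ->] := fg i j ij; have [|-> _] := fg j i; rewrite 1?eq_sym.
Qed.

(** * Ranks, and inversions of ordinary permutations *)

Definition rank n (a : 'I_n -> int) (i : 'I_n) : nat := #|[set j | a j < a i]|.

Lemma rank_ltn n (a : 'I_n -> int) i : (rank a i < n)%N.
Proof.
rewrite -[X in (_ < X)%N]card_ord -cardsT; apply: proper_card.
by rewrite properE subsetT; apply/subsetPn; exists i; rewrite !inE ?ltxx.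
Qed.

Lemma ltn_rank n (a : 'I_n -> int) i j : (rank a i < rank a j)%N = (a i < a j).
Proof.
have mono k l : a k <= a l -> (rank a k <= rank a l)%N.
  by move=> kl; apply/subset_leq_card/subsetP => x; rewrite !inE => /lt_le_trans->.
case: (ltP (a i) (a j)) => [ij | /mono]; last by rewrite leqNgt => /negbTE.
apply: proper_card; apply/properP; split.
  by apply/subsetP => x; rewrite !inE => /lt_trans->.
by exists i; rewrite !inE ?ltxx.
Qed.

Lemma rank_perm n (a : 'I_n -> int) : injective a ->
  {r : {perm 'I_n} | forall i j, (r i < r j)%N = (a i < a j)}.
Proof.
move=> a_inj; pose r i := Ordinal (rank_ltn a i).
have r_inj : injective r.
  move=> i j /(congr1 val) /= eq_ij; apply: a_inj; apply/eqP.
  by case: ltgtP (ltn_rank a i j) (ltn_rank a j i); rewrite // eq_ij ltnn.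
by exists (perm r_inj) => i j; rewrite !permE; apply: ltn_rank.
Qed.

Lemma sum_ltn_ord n i : (i <= n)%N -> (\sum_(j < n) (j < i) = i)%N.
Proof.
move=> le_in; rewrite -[RHS]card_ord -sum1_card (big_ord_widen n (fun=> 1%N) le_in).
by rewrite [RHS]big_mkcond; apply: eq_bigr => j _; case: ltnP.
Qed.

Lemma card_ltn_ord n (i : 'I_n) : #|[set j : 'I_n | (j < i)%N]| = i.
Proof.
rewrite -sum1dep_card big_mkcond /= -[RHS](@sum_ltn_ord n i) ?(ltnW (ltn_ord i)) //.
Qed.

(** If s is increasing, then s i is the number of values below s i, which are the
    images of the i indices below i. *)
Lemma increasing_perm n (s : {perm 'I_n}) :
  (forall i j : 'I_n, (i < j)%N -> (s i < s j)%N) -> s = 1%g.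
Proof.
move=> s_incr; apply/permP => i; rewrite perm1; apply: val_inj => /=.
rewrite -[LHS]card_ltn_ord -[RHS]card_ltn_ord -[RHS](card_imset _ (@perm_inj _ s)).
apply: eq_card => j; rewrite inE -[j](permKV s) mem_imset ?inE; last exact: perm_inj.
set k := _ j; case: (ltngtP k i) => [/s_incr //| /s_incr ik | /val_inj ->].
  by apply/negbTE; rewrite -leqNgt; apply: ltnW.
by rewrite ltnn.
Qed.

Definition inv_perm n (s : {perm 'I_n}) : nat :=
  \sum_(i < n) \sum_(j < n | (i < j)%N) (s j < s i)%N.

(** The first letter, of value i, is larger than exactly i of the letters to its
    right. *)
Lemma inv_lift_perm n (i : 'I_n.+1) (s : {perm 'I_n}) :
  inv_perm (lift_perm ord0 i s) = (i + inv_perm s)%N.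
Proof.
rewrite /inv_perm big_ord_recl; congr (_ + _)%N.
  rewrite big_mkcond big_ord_recl /= add0n lift_perm_id.
  under eq_bigr => j _ do rewrite lift_perm_lift.
  rewrite (reindex_inj (@perm_inj _ s^-1%g)) /=.
  under eq_bigr => j _ do rewrite permKV.
  rewrite -[RHS](@sum_ltn_ord n i (ltn_ord i)); apply: eq_bigr => j _.
  by rewrite /= /bump; case: leqP => ij; lia.
apply: eq_bigr => j _; rewrite [LHS]big_mkcond big_ord_recl /= add0n [RHS]big_mkcond.
apply: eq_bigr => k _; rewrite !lift_perm_lift /= /bump !add1n ltnS; case: ifP => // _.
by congr nat_of_bool; case: (leqP i (s k)); case: (leqP i (s j)) => *; lia.
Qed.

Lemma lift_perm_bij n :
  bijective (fun p : 'I_n.+1 * {perm 'I_n} => lift_perm ord0 p.1 p.2).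
Proof.
apply: inj_card_bij => [[i s] [j t] /= eq_st|].
  have eq_ij : i = j by have := congr1 (fun u : {perm _} => u ord0) eq_st; rewrite !lift_perm_id.
  congr pair => //; apply/permP => k; apply: (@lift_inj _ i).
  by rewrite -(lift_perm_lift ord0) eq_st lift_perm_lift eq_ij.
by rewrite card_prod !card_Sn card_ord factS.
Qed.

(** By [inv_lift_perm], splitting off the first of n + 1 letters splits off the
    factor [n + 1]_q. *)
Lemma inversion_gf n : \sum_(s : {perm 'I_n}) 'X^(inv_perm s) = qfact n.
Proof.
elim: n => [|n IHn].
  rewrite (bigD1 1%g) //= big1 => [|s]; last first.
    by case/eqP; apply/permP => -[].
  by rewrite /inv_perm big_ord0 addr0 /qfact big_nil.
rewrite (reindex _ (onW_bij _ (@lift_perm_bij n))) /=.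
rewrite /qfact big_nat_recr //= -/(qfact n) -IHn /qint mulrC big_distrlr /=.
rewrite pair_bigA /=; apply: eq_bigr => -[i s] _ /=.
by rewrite inv_lift_perm exprD.
Qed.

(** * The group of signed permutations *)

Lemma groupBP n (w : {perm sidx n}) :
  reflect (forall x, w (sidx_opp x) = sidx_opp (w x)) (w \in groupB n).
Proof. by rewrite inE; apply: (iffP forallP) => odd_w x; apply/eqP. Qed.

Lemma groupB_group_set n : group_set (groupB n).
Proof.
apply/group_setP; split=> [|v w /groupBP odd_v /groupBP odd_w].
  by apply/groupBP => x; rewrite !perm1.
by apply/groupBP => x; rewrite !permM odd_v odd_w.
Qed.
Canonical groupB_group n := Group (groupB_group_set n).

Lemma abs_letter_inj n (w : {perm sidx n}) :
  w \in groupB n -> injective (fun i => (w (false, i)).2).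
Proof.
move=> /groupBP odd_w i j /= eq_ij.
have : w (false, i) = w (false, j) \/ w (false, i) = w (true, j).
  rewrite (odd_w (false, j)) [w (_, i)]surjective_pairing.
  rewrite [w (_, j)]surjective_pairing eq_ij /sidx_opp /=.
  by case: (w _).1; case: (w _).1; [left|right|right|left].
by case=> /perm_inj[].
Qed.

Lemma sidx_valN n (x : sidx n) : sidx_val (sidx_opp x) = - sidx_val x.
Proof. by case: x => -[] i; rewrite /sidx_val /= ?expr0 ?expr1; lia. Qed.

Lemma sidx_val_inj n : injective (@sidx_val n).
Proof.
move=> [b i] [c j]; rewrite /sidx_val /= => eq_ij.
have [-> /val_inj-> //] : b = c /\ i = j :> nat.
by case: b c eq_ij => -[]; rewrite /= ?expr0 ?expr1; split=> //; lia.
Qed.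

(** The signs of the letters a (false, i) and the ranks of their absolute values
    form a signed permutation, which orders all letters as a does because a is
    odd. *)
Lemma signed_rank k (a : sidx k -> int) :
    injective a -> (forall x, a (sidx_opp x) = - a x) ->
  {h : {perm sidx k} | h \in groupB k &
     forall x y, (sidx_val (h x) < sidx_val (h y)) = (a x < a y)}.
Proof.
move=> a_inj a_odd; pose b i := `|a (false, i)|; pose neg i := a (false, i) < 0.
have aE c i : a (c, i) = (-1) ^+ (c (+) neg i) * b i.
  have -> : a (c, i) = (-1) ^+ c * a (false, i).
    by case: c; rewrite ?mul1r // mulN1r -a_odd.
  by rewrite signr_addb -mulrA /neg; congr (_ * _); rewrite -numEsign.
have b_gt0 i : 0 < b i.
  rewrite normr_gt0; apply/eqP => ai0.
  by have /a_inj : a (sidx_opp (false, i)) = a (false, i) by rewrite a_odd ai0 oppr0.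
have b_inj : injective b.
  move=> i j eq_b; have /a_inj[] // : a (neg i, i) = a (neg j, j).
  by rewrite !aE !addbb eq_b.
have [r rE] := rank_perm b_inj.
pose h (x : sidx k) : sidx k := (x.1 (+) neg x.2, r x.2).
have h_inj : injective h.
  by move=> [c i] [d j] [] /= eq_c /perm_inj eq_ij; move: eq_c; rewrite eq_ij => /addIb->.
exists (perm h_inj) => [|[c i] [d j]].
  by apply/groupBP => x; rewrite !permE /h /sidx_opp /= addNb.
rewrite !permE !aE /sidx_val /h /=.
have := (rE i j, rE j i, b_gt0 i, b_gt0 j).
move: (b i) (b j) (r i : nat) (r j : nat) => B B' R R' [[[e1 e2] B0] B'0].
by case: (c (+) _); case: (d (+) _); rewrite ?expr0 ?expr1 ?mulN1r ?mul1r; lia.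
Qed.

Definition Bsum n (P : ('I_n -> int) -> bool) : {poly int} :=
  \sum_(w in groupB n) (P (letter w))%:R * 'X^(invD w).

(** By [signed_rank] the valuation is, up to order, a translate of the standard
    one by an element of the group. *)
Lemma Bsum_valuation k (a : sidx k -> int) (G : ('I_k -> int) -> {poly int}) :
    injective a -> (forall x, a (sidx_opp x) = - a x) -> order_invariant G ->
  \sum_(x in groupB k) G (fun i => a (x (false, i)))
  = \sum_(x in groupB k) G (letter x).
Proof.
move=> a_inj a_odd G_inv; have [h Bh hE] := signed_rank a_inj a_odd.
rewrite [RHS](reindex_inj (mulIg h)); apply: eq_big => x; first by rewrite groupMr.
move=> /groupBP odd_x; apply: G_inv => i j _; rewrite /letter !permM.
by rewrite -a_odd -sidx_valN -!hE (groupBP _ Bh).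
Qed.

Definition Asum m (Q : ('I_m -> int) -> bool) : {poly int} :=
  \sum_(y : {perm 'I_m}) (Q (fun j => (y j : nat)%:Z))%:R * 'X^(inv_perm y).

Lemma Asum_valuation m (v : 'I_m -> int) (G : ('I_m -> int) -> {poly int}) :
    injective v -> pattern_invariant G ->
  \sum_(y : {perm 'I_m}) G (fun j => v (y j))
  = \sum_(y : {perm 'I_m}) G (fun j => (y j : nat)%:Z).
Proof.
move=> v_inj G_inv; have [r rE] := rank_perm v_inj.
rewrite [RHS](reindex_inj (mulIg r)); apply: eq_bigr => y _.
by apply: G_inv => i j; rewrite !permM ltz_nat rE.
Qed.

(** * Block decomposition *)

(** The action on positions: x permutes and changes signs in the first block, y
    only permutes the second one. *)
Definition block_fun k m (x : {perm sidx k}) (y : {perm 'I_m}) (p : sidx (k + m)) :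
    sidx (k + m) :=
  match split p.2 with
  | inl i => ((x (p.1, i)).1, lshift m (x (p.1, i)).2)
  | inr j => (p.1, rshift k (y j))
  end.

Lemma block_fun_inj k m (x : {perm sidx k}) (y : {perm 'I_m}) :
  injective (block_fun x y).
Proof.
move=> [b i] [c j]; rewrite /block_fun /=.
case: (split_ordP i) => i' ->; case: (split_ordP j) => j' ->.
- move=> /pair_equal_spec[eq1 /lshift_inj eq2].
  have /perm_inj[-> ->] // : x (b, i') = x (c, j').
  by rewrite [LHS]surjective_pairing eq1 eq2 -surjective_pairing.
- by move=> /pair_equal_spec[_ /eqP]; rewrite eq_lrshift.
- by move=> /pair_equal_spec[_ /eqP]; rewrite eq_rlshift.
by move=> /pair_equal_spec[-> /rshift_inj/perm_inj->].
Qed.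

Definition block_perm k m x y : {perm sidx (k + m)} := perm (@block_fun_inj k m x y).

Lemma block_perm_groupB k m (x : {perm sidx k}) (y : {perm 'I_m}) :
  x \in groupB k -> block_perm x y \in groupB (k + m).
Proof.
move=> /groupBP odd_x; apply/groupBP => -[b i]; rewrite !permE /block_fun /=.
by case: (split i) => j //; rewrite (odd_x (b, j)).
Qed.

Definition left_val k m (w : {perm sidx (k + m)}) (x : sidx k) : int :=
  sidx_val (w (x.1, lshift m x.2)).
Definition left_word k m (f : 'I_(k + m) -> int) (i : 'I_k) := f (lshift m i).
Definition right_word k m (f : 'I_(k + m) -> int) (j : 'I_m) := f (rshift k j).

(** Pairs with one letter in each block contribute evenly in the sign of the left
    letter, so the block action leaves their total unchanged. *)
Definition cross k m (f : 'I_(k + m) -> int) : nat :=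
  (\sum_(i < k) \sum_(j < m)
    ((f (rshift k j) < f (lshift m i))%R + (f (rshift k j) < - f (lshift m i))%R))%N.

Lemma left_block_perm k m (w : {perm sidx (k + m)}) x y :
  left_word (letter (block_perm x y * w)) =1 (fun i => left_val w (x (false, i))).
Proof.
move=> i; rewrite /left_word /letter permM permE /block_fun /left_val /=.
by rewrite -[lshift m i]/(unsplit (inl i)) unsplitK.
Qed.

Lemma right_block_perm k m (w : {perm sidx (k + m)}) x y :
  right_word (letter (block_perm x y * w)) =1 (fun j => letter w (rshift k (y j))).
Proof.
move=> j; rewrite /right_word /letter permM permE /block_fun /=.
by rewrite -[rshift k j]/(unsplit (inr j)) unsplitK.
Qed.

Lemma left_val_inj k m (w : {perm sidx (k + m)}) : injective (left_val w).
Proof.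
by move=> [b i] [c j] /sidx_val_inj/perm_inj/pair_equal_spec[/= -> /lshift_inj->].
Qed.

Lemma left_valN k m (w : {perm sidx (k + m)}) x :
  w \in groupB (k + m) -> left_val w (sidx_opp x) = - left_val w x.
Proof. by move=> /groupBP odd_w; rewrite -sidx_valN -odd_w. Qed.

Lemma letter_inj n (w : {perm sidx n}) : injective (letter w).
Proof. by move=> i j /sidx_val_inj/perm_inj[]. Qed.

(** Twice the sum runs over all ordered pairs of distinct indices, a set that is
    stable under y. *)
Lemma sum_pairs_perm m (F : 'I_m -> 'I_m -> nat) (y : {perm 'I_m}) :
    (forall i j, F i j = F j i) ->
  (\sum_(i < m) \sum_(j < m | (i < j)%N) F (y i) (y j)
   = \sum_(i < m) \sum_(j < m | (i < j)%N) F i j)%N.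
Proof.
move=> F_sym.
have double (G : 'I_m -> 'I_m -> nat) : (forall i j, G i j = G j i) ->
    ((\sum_(i < m) \sum_(j < m | (i < j)%N) G i j).*2
     = \sum_(i < m) \sum_(j < m | j != i) G i j)%N.
  move=> G_sym; transitivity (\sum_(i < m)
      (\sum_(j < m | (i < j)%N) G i j + \sum_(j < m | (j < i)%N) G i j))%N.
    rewrite big_split -addnn; congr (_ + _)%N => /=.
    rewrite (exchange_big_dep xpredT) //=.
    by apply: eq_bigr => i _; apply: eq_bigr => j _.
  apply: eq_bigr => i _; rewrite [RHS](bigID (fun j : 'I_m => (i < j)%N)) /=.
  congr (_ + _)%N; apply: eq_bigl => j; rewrite -val_eqE /=; lia.
apply: double_inj; rewrite (double F F_sym) (double _ (fun i j => F_sym (y i) (y j))).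
rewrite [RHS](reindex_inj (@perm_inj _ y)); apply: eq_bigr => i _.
rewrite [RHS](reindex_inj (@perm_inj _ y)); apply: eq_bigl => j.
by rewrite (inj_eq perm_inj).
Qed.

(** The last summand collects what the block action preserves. *)
Lemma inv_word_split k m (f : 'I_(k + m) -> int) :
  (inv_word f + nsp_word f = inv_word (left_word f) + nsp_word (left_word f)
     + inv_word (right_word f) + (cross f + nsp_word (right_word f)))%N.
Proof.
have split_pairs (F : 'I_(k + m) -> 'I_(k + m) -> nat) :
    (\sum_(i < k + m) \sum_(j < k + m | (i < j)%N) F i j
     = \sum_(i < k) \sum_(j < k | (i < j)%N) F (lshift m i) (lshift m j)
       + \sum_(i < k) \sum_(j < m) F (lshift m i) (rshift k j)
       + \sum_(i < m) \sum_(j < m | (i < j)%N) F (rshift k i) (rshift k j))%N.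
  rewrite big_split_ord -big_split; congr (_ + _)%N; apply: eq_bigr => i _.
    rewrite big_split_ord /=; congr (_ + _)%N; apply: eq_bigl => j.
    by rewrite ltn_addr.
  rewrite big_split_ord /= big1 ?add0n => [|j]; last by have := ltn_ord j; lia.
  by apply: eq_bigl => j; rewrite ltn_add2l.
have -> : cross f =
    (\sum_(i < k) \sum_(j < m) (f (rshift k j) < f (lshift m i))%R
     + \sum_(i < k) \sum_(j < m) (f (rshift k j) < - f (lshift m i))%R)%N.
  by rewrite -big_split; apply: eq_bigr => i _; rewrite -big_split.
rewrite /inv_word /nsp_word !split_pairs /left_word /right_word; lia.
Qed.

Lemma cross_block_perm k m (w : {perm sidx (k + m)}) x (y : {perm 'I_m}) :
    w \in groupB (k + m) -> x \in groupB k ->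
  cross (letter (block_perm x y * w)) = cross (letter w).
Proof.
move=> Bw Bx.
pose E c := (\sum_(j < m)
  ((letter w (rshift k j) < c)%R + (letter w (rshift k j) < - c)%R))%N.
have E_even c : E (- c) = E c.
  by apply: eq_bigr => j _; rewrite opprK addnC.
rewrite [RHS](_ : _ = \sum_(i < k) E (letter w (lshift m i)))%N //.
rewrite [RHS](reindex_inj (abs_letter_inj Bx)); apply: eq_bigr => i _.
rewrite (_ : E _ = E (left_val w (x (false, i)))).
  rewrite /E [RHS](reindex_inj (@perm_inj _ y)); apply: eq_bigr => j _.
  have := (left_block_perm w x y i, right_block_perm w x y j).
  by rewrite /left_word /right_word => -[<- <-].
rewrite [x _]surjective_pairing; case: (x _).1 => //.
by rewrite -[RHS]E_even -left_valN.
Qed.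

Lemma nsp_block_perm k m (w : {perm sidx (k + m)}) x (y : {perm 'I_m}) :
  nsp_word (right_word (letter (block_perm x y * w)))
  = nsp_word (right_word (letter w)).
Proof.
pose F i j : nat := letter w (rshift k j) < - letter w (rshift k i).
rewrite -[RHS](@sum_pairs_perm m F y) => [|i j]; last by rewrite /F ltrNr.
apply: eq_bigr => i _; apply: eq_bigr => j _.
by rewrite !right_block_perm.
Qed.

(** Every translate of the sum by a block permutation has the same value; summing
    over all of them and exchanging the sums, the inner sum over the block
    permutations factors for each fixed w.  Using this with two pairs (P, Q) and
    dividing removes the sum over w. *)
Lemma Bsum_blocks k m (P : ('I_k -> int) -> bool) (Q : ('I_m -> int) -> bool) :
    order_invariant P -> pattern_invariant Q ->
  (#|groupB k| * m`!)%:R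
    * Bsum (fun f => P (@left_word k m f) && Q (@right_word k m f))
  = (\sum_(w in groupB (k + m))
       'X^(cross (letter w) + nsp_word (right_word (letter w))))
    * (Bsum P * Asum Q).
Proof.
move=> P_inv Q_inv; set PQ := fun f => _.
have translate x y : x \in groupB k ->
    Bsum PQ = \sum_(w in groupB (k + m)) (PQ (letter (block_perm x y * w)))%:R
                * 'X^(invD (block_perm x y * w)).
  move=> Bx; rewrite [LHS](reindex_inj (mulgI (block_perm x y))).
  by apply: eq_bigl => w; rewrite groupMl // block_perm_groupB.
transitivity (\sum_(x in groupB k) \sum_(y : {perm 'I_m}) Bsum PQ).
  by rewrite !sumr_const card_Sn -mulrnA mulr_natl mulnC.
transitivity (\sum_(w in groupB (k + m)) \sum_(x in groupB k) \sum_(y : {perm 'I_m})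
    (PQ (letter (block_perm x y * w)))%:R * 'X^(invD (block_perm x y * w)) : {poly int}).
  rewrite [RHS]exchange_big /=; apply: eq_bigr => x Bx.
  by rewrite [RHS]exchange_big /=; apply: eq_bigr => y _; apply: translate.
rewrite big_distrl; apply: eq_bigr => w Bw /=.
pose GP (f : 'I_k -> int) : {poly int} := (P f)%:R * 'X^(inv_word f + nsp_word f).
pose GQ (f : 'I_m -> int) : {poly int} := (Q f)%:R * 'X^(inv_word f).
have GP_inv : order_invariant GP.
  move=> f g fg; rewrite /GP (P_inv f g) // (nsp_word_invariant fg).
  by rewrite (inv_word_pattern (same_order_pattern fg)).
have -> : Bsum P = \sum_(x in groupB k) GP (fun i => left_val w (x (false, i))).
  rewrite (Bsum_valuation (@left_val_inj _ _ w) _ GP_inv) => [|x]; last exact: left_valN.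
  by apply: eq_bigr => x _; rewrite invDE.
have v_inj : injective (fun j => letter w (rshift k j)).
  by move=> i j /letter_inj/rshift_inj.
have GQ_inv : pattern_invariant GQ.
  by move=> f g fg; rewrite /GQ (Q_inv f g) // (inv_word_pattern fg).
have -> : Asum Q = \sum_(y : {perm 'I_m}) GQ (fun j => letter w (rshift k (y j))).
  rewrite (Asum_valuation v_inj GQ_inv); apply: eq_bigr => y _.
  by congr (_ * 'X^_).
rewrite big_distrlr /= big_distrr /=; apply: eq_bigr => x Bx.
rewrite big_distrr /=; apply: eq_bigr => y _.
have Plw := funext (left_block_perm w x y).
have Prw := funext (right_block_perm w x y).
rewrite invDE inv_word_split /PQ cross_block_perm // nsp_block_perm Plw Prw.
by rewrite /GP /GQ -mulnb natrM [X in _ * X]exprD [X in _ * (X * _)]exprD mulrA mulrACA mulrC.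
Qed.

(** * From signed to even-signed permutations *)

Lemma groupDE n (w : {perm sidx n}) :
  (w \in groupD n) = (w \in groupB n) && ~~ odd #|[set i | letter w i < 0]|.
Proof. exact: in_set. Qed.

Definition Dsum n (P : ('I_n -> int) -> bool) : {poly int} :=
  \sum_(w in groupD n) (P (letter w))%:R * 'X^(invD w).

Definition flip1 n : {perm sidx n.+1} := tperm (false, ord0) (true, ord0).

Lemma flip1E n (x : sidx n.+1) : flip1 n x = (x.1 (+) (x.2 == ord0), x.2).
Proof.
case: x => b i; rewrite /flip1; case: tpermP => [[-> ->]|[-> ->]|] /=; rewrite ?eqxx //.
case: (eqVneq i ord0) => [->|_ _ _]; last by rewrite addbF.
by case: b => [_ []|[]].
Qed.

Lemma flip1_groupB n : flip1 n \in groupB n.+1.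
Proof. by apply/groupBP => x; rewrite !flip1E /sidx_opp /= addNb. Qed.

(** The value 1 has the least absolute value, so its sign is invisible to the
    comparisons between different letters and their opposites. *)
Lemma same_order_flip1 n (w : {perm sidx n.+1}) :
  w \in groupB n.+1 -> same_order (letter (w * flip1 n)) (letter w).
Proof.
move=> Bw i j neq_ij; rewrite /letter !permM !flip1E.
have : (w (false, i)).2 != (w (false, j)).2 by rewrite (inj_eq (abs_letter_inj Bw)).
case: (w _) => b k; case: (w _) => c l /=; rewrite -!val_eqE /sidx_val /= => neq_kl.
by case: b; case: c; case: eqP => k0; case: eqP => l0;
  rewrite /= ?expr0 ?expr1; split; lia.
Qed.

Lemma invD_same_order n (v w : {perm sidx n}) :
  same_order (letter v) (letter w) -> invD v = invD w.
Proof.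
by move=> vw; rewrite !invDE (inv_word_pattern (same_order_pattern vw)) (nsp_word_invariant vw).
Qed.

Lemma odd_card n (P : pred 'I_n) : odd #|[set i | P i]| = \big[addb/false]_i P i.
Proof.
rewrite -sum1dep_card big_mkcond (big_morph odd oddD (erefl : odd 0 = false)) /=.
by apply: eq_bigr => i _; case: (P i).
Qed.

(** Exactly one position carries the value 1 or -1. *)
Lemma odd_negatives_flip1 n (w : {perm sidx n.+1}) : w \in groupB n.+1 ->
  odd #|[set i | letter (w * flip1 n) i < 0]| = ~~ odd #|[set i | letter w i < 0]|.
Proof.
move=> Bw; have [absV _ absK] := injF_bij (abs_letter_inj Bw).
pose i0 := absV ord0.
have i0E i : ((w (false, i)).2 == ord0) = (i == i0).
  by rewrite -[ord0]absK (inj_eq (abs_letter_inj Bw)).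
rewrite !odd_card.
transitivity (\big[addb/false]_i ((letter w i < 0) (+) (i == i0))).
  apply: eq_bigr => i _; rewrite -i0E /letter permM flip1E /sidx_val.
  case: (w _) => -[] j /=; case: (j == ord0); rewrite /= ?expr0 ?expr1; lia.
rewrite big_split /= -[RHS]addbT; congr (_ (+) _).
by rewrite (bigD1 i0) //= eqxx big1 // => i /negPf.
Qed.

(** Right multiplication by [flip1] exchanges the even-signed elements with the
    other ones. *)
Lemma Bsum_Dsum n (P : ('I_n.+1 -> int) -> bool) :
  order_invariant P -> Bsum P = 2 * Dsum P.
Proof.
move=> P_inv; rewrite /Bsum (bigID (mem (groupD n.+1))) /= mulr2n mulrDl mul1r.
congr (_ + _); last rewrite (reindex_inj (mulIg (flip1 n))) /=.
  by apply: eq_bigl => w; rewrite groupDE; case: (w \in groupB _).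
apply: eq_big => w.
  rewrite !groupDE groupMr ?flip1_groupB //; case Bw: (w \in groupB _) => //=.
  by rewrite odd_negatives_flip1 ?Bw // !negbK.
move=> /andP[Bw _]; rewrite groupMr ?flip1_groupB // in Bw.
by have so := same_order_flip1 Bw; rewrite (P_inv _ _ so) (invD_same_order so).
Qed.

Definition flip_first n (f : 'I_n.+1 -> int) i := if i == ord0 then - f i else f i.

(** A letter counts in inv_D through its absolute value for all pairs in which it
    comes first, and the first letter is never second in a pair. *)
Lemma Bsum_flip_first n (P : ('I_n.+1 -> int) -> bool) :
  Bsum (fun f => P (flip_first f)) = Bsum P.
Proof.
rewrite [RHS](reindex_inj (mulgI (flip1 n))); apply: eq_big => w.
  by rewrite groupMl // flip1_groupB.
move=> Bw; have letterE : letter (flip1 n * w) = flip_first (letter w).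
  apply: funext => i; rewrite /letter permM flip1E /flip_first /=.
  by case: (i == ord0) => //; rewrite -sidx_valN -(groupBP _ Bw).
rewrite -letterE; congr (_ * 'X^_); rewrite !invDE letterE.
rewrite /inv_word /nsp_word -!big_split /=; apply: eq_bigr => i _.
rewrite -!big_split /=; apply: eq_bigr => j ij; rewrite /flip_first.
have /negPf-> : j != ord0 by rewrite -val_eqE /=; lia.
by case: eqP => // _; rewrite opprK addnC.
Qed.

(** * Frequencies of patterns *)

Lemma ratq_ofD : {morph ratq_of : p q / p + q}.
Proof. by move=> p q; rewrite /ratq_of !rmorphD. Qed.
Lemma ratq_ofM : {morph ratq_of : p q / p * q}.
Proof. by move=> p q; rewrite /ratq_of !rmorphM. Qed.
Lemma ratq_of1 : ratq_of 1 = 1.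
Proof. by rewrite /ratq_of !rmorph1. Qed.

Definition Dfreq n (P : ('I_n -> int) -> bool) : ratq :=
  ratq_of (Dsum P) / ratq_of (polyD1 n).

Lemma Dsum_true n : Dsum (fun _ : 'I_n -> int => true) = polyD1 n.
Proof. by apply: eq_bigr => w _; rewrite mul1r. Qed.

Lemma eq_Dfreq n (P Q : ('I_n -> int) -> bool) :
  (forall w : {perm sidx n}, P (letter w) = Q (letter w)) -> Dfreq P = Dfreq Q.
Proof. by move=> PQ; congr (ratq_of _ / _); apply: eq_bigr => w _; rewrite PQ. Qed.

Lemma Dfreq_true n : Dfreq (fun _ : 'I_n -> int => true) = 1.
Proof. by rewrite /Dfreq Dsum_true divff // polyD1_neq0. Qed.

Lemma Dfreq_split n (P R : ('I_n -> int) -> bool) :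
  Dfreq P = Dfreq (fun f => P f && R f) + Dfreq (fun f => P f && ~~ R f).
Proof.
rewrite /Dfreq -mulrDl -ratq_ofD -big_split; congr (ratq_of _ / _).
apply: eq_bigr => w _ /=; rewrite -mulrDl -natrD; congr (_%:R * _).
by case: (P _); case: (R _).
Qed.

(** In length 0 there is no letter to flip, and the multiple is 1 instead of 2. *)
Lemma Bsum_Dsum_multiple n : exists2 c : {poly int}, c != 0 &
  forall P : ('I_n -> int) -> bool, order_invariant P -> Bsum P = c * Dsum P.
Proof.
case: n => [|n]; last first.
  exists 2; last exact: Bsum_Dsum.
  by rewrite -polyC_natr polyC_eq0.
exists 1; first exact: oner_neq0.
move=> P _; rewrite mul1r; apply: eq_bigl => w.
rewrite groupDE (_ : [set i | _] = set0) ?cards0 ?andbT //.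
by apply/setP => -[].
Qed.

Lemma increasing_perm1 m (y : {perm 'I_m}) :
  increasing (fun j => (y j : nat)%:Z) = (y == 1%g).
Proof.
apply/idP/eqP => [incr_y | ->].
  apply: increasing_perm => i j ij.
  by have /forallP/(_ i)/forallP/(_ j)/implyP/(_ ij) := incr_y.
by apply/forallP => i; apply/forallP => j; apply/implyP; rewrite !perm1.
Qed.

Lemma Asum_increasing m : Asum (@increasing m) = 1.
Proof.
rewrite /Asum (bigD1 1%g) //= big1 => [|y /negPf y1]; last first.
  by rewrite increasing_perm1 y1 mul0r.
rewrite increasing_perm1 eqxx addr0 mul1r (_ : inv_perm _ = 0%N) //.
by apply: big1 => i _; apply: big1 => j ij; rewrite !perm1 ltnNge ltnW.
Qed.

Lemma Asum_true m : Asum (fun _ : 'I_m -> int => true) = qfact m.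
Proof. by rewrite -inversion_gf; apply: eq_bigr => y _; rewrite mul1r. Qed.

Lemma div_div_eq (F : fieldType) (a b c d q : F) :
  b != 0 -> d != 0 -> q != 0 -> b * c = a * (d * q) -> a / b = c / d / q.
Proof.
move=> b0 d0 q0 eq_ab; rewrite -mulrA -invfM; apply/eqP.
by rewrite eqr_div ?mulf_neq0 // -eq_ab mulrC.
Qed.

(** [Bsum_blocks] for (P, increasing) and for the trivial patterns, divided one by
    the other. *)
Lemma Dfreq_blocks k m (P : ('I_k -> int) -> bool) : order_invariant P ->
  Dfreq (fun f => P (@left_word k m f) && increasing (@right_word k m f))
  = Dfreq P / ratq_of (qfact m).
Proof.
move=> P_inv; set PQ := fun f => _.
have PQ_inv : order_invariant PQ.
  move=> f g fg; rewrite /PQ (P_inv _ (left_word g)); last first.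
    by move=> i j ij; apply: fg; rewrite (inj_eq (@lshift_inj _ _)).
  congr (_ && _); apply/increasing_pattern/same_order_pattern => i j ij.
  by apply: fg; rewrite eq_rshift.
have [c c0 cE] := Bsum_Dsum_multiple (k + m).
have [d d0 dE] := Bsum_Dsum_multiple k.
have true_inv n : order_invariant (fun _ : 'I_n -> int => true) by [].
have true_pattern : pattern_invariant (fun _ : 'I_m -> int => true) by [].
have := Bsum_blocks P_inv (@increasing_pattern m).
have := Bsum_blocks (true_inv k) true_pattern.
rewrite Asum_increasing Asum_true /= -/PQ !cE ?dE // !Dsum_true mulr1.
set N := _%:R; set C := \sum_(w in _) _ => eqT eqPQ.
have N0 : N != 0.
  rewrite /N -polyC_natr polyC_eq0 pnatr_eq0 -lt0n muln_gt0 fact_gt0 andbT.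
  by rewrite cardG_gt0.
have eqD : polyD1 (k + m) * Dsum P = Dsum PQ * (polyD1 k * qfact m).
  apply: (mulfI N0); apply: (mulfI c0); apply: (mulfI d0).
  have -> : d * (c * (N * (polyD1 (k + m) * Dsum P)))
     = (N * (c * polyD1 (k + m))) * (d * Dsum P) by ring.
  transitivity (C * (d * Dsum P) * (d * polyD1 k * qfact m)); first by rewrite eqT; ring.
  by rewrite -eqPQ; ring.
have := congr1 ratq_of eqD; rewrite !ratq_ofM /Dfreq => eqq.
have [[D0 Dk0] q0] := (polyD1_neq0 (k + m), polyD1_neq0 k, qfact_neq0 m).
exact: div_div_eq eqq.
Qed.

(** * Patterns of consecutive comparisons *)

(** Words are read at natural positions, so that patterns can be cut and extended
    without casts between ordinals. *)
Definition extend0 n (f : 'I_n -> int) (i : nat) : int :=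
  if insub i is Some j then f j else 0.
Definition zigzag (g : nat -> int) a b :=
  all (fun i => if odd i then g i < g i.+1 else g i.+1 < g i) (index_iota a b).
Definition rising (g : nat -> int) a b :=
  all (fun i => g i < g i.+1) (index_iota a b).

Lemma extend0_ord n (f : 'I_n -> int) i (ltin : (i < n)%N) : extend0 f i = f (Ordinal ltin).
Proof. by rewrite /extend0 insubT. Qed.

Lemma extend0_left k m (f : 'I_(k + m) -> int) i :
  (i < k)%N -> extend0 (left_word f) i = extend0 f i.
Proof.
move=> ik; rewrite (extend0_ord _ ik) (extend0_ord f (ltn_addr m ik)).
by congr f; apply: val_inj.
Qed.

Lemma extend0_right k m (f : 'I_(k + m) -> int) j :
  (j < m)%N -> extend0 (right_word f) j = extend0 f (k + j).
Proof.
move=> jm; have kj : (k + j < k + m)%N by rewrite ltn_add2l.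
by rewrite (extend0_ord _ jm) (extend0_ord f kj); congr f; apply: val_inj.
Qed.

Lemma rising_cons g a b : (a < b)%N ->
  rising g a b = (g a < g a.+1) && rising g a.+1 b.
Proof. by move=> ab; rewrite /rising /index_iota -(prednK (n := b - a)) ?subnS //= subn_gt0. Qed.

Lemma rising_nil g a b : (b <= a)%N -> rising g a b.
Proof. by rewrite /rising /index_iota -subn_eq0 => /eqP->. Qed.

Lemma zigzag_rcons g a b : (a <= b)%N ->
  zigzag g a b.+1 = zigzag g a b && (if odd b then g b < g b.+1 else g b.+1 < g b).
Proof.
by move=> ab; rewrite /zigzag /index_iota subSn // -addn1 iotaD all_cat /= andbT subnKC.
Qed.

Lemma rising_lt (g : nat -> int) a b i j : rising g a b ->
  (a <= i < j)%N -> (j <= b)%N -> g i < g j.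
Proof.
move=> /allP rise /andP[ai]; elim: j => // j IHj; rewrite ltnS leq_eqVlt.
have step k : (a <= k < b)%N -> g k < g k.+1.
  by move=> kab; apply: rise; rewrite mem_index_iota.
case/predU1P => [<-|ij] jb; first by apply: step; rewrite ai.
apply: lt_trans (IHj ij (ltnW jb)) (step j _).
by rewrite jb (leq_trans ai (ltnW ij)).
Qed.

Lemma eq_rising g h a b : (forall i, (a <= i <= b)%N -> g i = h i) ->
  rising g a b = rising h a b.
Proof.
move=> gh; apply: eq_in_all => i; rewrite mem_index_iota => /andP[ai ib].
by rewrite !gh //; lia.
Qed.

Lemma increasingE n (f : 'I_n -> int) : increasing f = rising (extend0 f) 0 n.-1.
Proof.
apply/idP/idP => [incr_f | rise].
  apply/allP => i; rewrite mem_index_iota => /= ltin.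
  have [lt1 lt2] : (i < n)%N /\ (i.+1 < n)%N by lia.
  rewrite (extend0_ord f lt1) (extend0_ord f lt2).
  by have /forallP/(_ (Ordinal lt1))/forallP/(_ (Ordinal lt2)) := incr_f; rewrite ltnSn.
apply/forallP => i; apply/forallP => j; apply/implyP => ij.
have := rising_lt (i := i) (j := j) rise; rewrite /= ij => /(_ isT).
rewrite !(extend0_ord f (ltn_ord _)); have lej : (j <= n.-1)%N by have := ltn_ord j; lia.
by move=> /(_ lej); congr (f _ < f _); apply: val_inj.
Qed.

Lemma increasing_right k m (f : 'I_(k + m) -> int) :
  increasing (right_word f) = rising (extend0 f) k (k + m.-1).
Proof.
rewrite increasingE; transitivity (all
    (fun i => extend0 f (k + i) < extend0 f (k + i).+1) (index_iota 0 m.-1)).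
  apply: eq_in_all => i; rewrite mem_index_iota /= => im.
  by rewrite !extend0_right ?addnS //; lia.
have iotaE : iota k m.-1 = [seq (k + i)%N | i <- iota 0 m.-1] by rewrite -iotaDl addn0.
by rewrite /rising /index_iota subn0 addKn iotaE all_map.
Qed.

Lemma snake_wordE n (f : 'I_n -> int) : (1 < n)%N ->
  snake_word f = (extend0 f 0 < - extend0 f 1) && zigzag (extend0 f) 0 n.-1.
Proof.
move=> n1; apply/idP/idP => [snake | /andP[neg /allP zz]].
  have step i : (i.+1 < n)%N -> ((i == 0)%N ==> (extend0 f i < - extend0 f i.+1)) &&
      (if odd i then extend0 f i < extend0 f i.+1 else extend0 f i.+1 < extend0 f i).
    move=> lt2; have lt1 := ltnW lt2; rewrite (extend0_ord f lt1) (extend0_ord f lt2).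
    by have /forallP/(_ (Ordinal lt1))/forallP/(_ (Ordinal lt2)) := snake; rewrite eqxx.
  apply/andP; split; first by have := step 0%N n1; rewrite eqxx => /andP[].
  apply/allP => i; rewrite mem_index_iota => /= ltin.
  by have /step/andP[] : (i.+1 < n)%N by lia.
apply/forallP => i; apply/forallP => j; apply/implyP => /eqP eqj.
have fE (l : 'I_n) : f l = extend0 f l.
  by rewrite (extend0_ord f (ltn_ord l)); congr f; apply: val_inj.
rewrite !fE eqj; apply/andP; split; first by apply/implyP => /eqP->.
by apply: zz; rewrite mem_index_iota /=; have := ltn_ord j; lia.
Qed.

(** * The recursion for snakes *)

Lemma snake_coefE n : snake_coef n = Dfreq (@snake_word n).
Proof.
congr (ratq_of _ / _); rewrite /polyS /Dsum big_mkcondr; apply: eq_bigr => w _.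
rewrite -[dsnake w]/(snake_word (letter w)).
by case: (snake_word _); rewrite ?mul1r ?mul0r.
Qed.

(** The minimum stops the zigzag at the end of the word: for n = 2j the
    step from index 2j - 1 would leave the word. *)
Definition partial_snake n j (f : 'I_n -> int) : bool :=
  [&& extend0 f 0 < - extend0 f 1, zigzag (extend0 f) 0 (minn j.*2 n.-1)
    & rising (extend0 f) j.*2 n.-1].

Lemma partial_snake_last n j : (1 < n)%N -> (n.-1 <= j.*2)%N ->
  Dfreq (@partial_snake n j) = snake_coef n.
Proof.
move=> n1 nj; rewrite snake_coefE; apply: eq_Dfreq => w.
by rewrite /partial_snake (minn_idPr nj) rising_nil // andbT snake_wordE.
Qed.

Lemma letter_nltE n (w : {perm sidx n}) i j : (i < n)%N -> (j < n)%N -> i != j ->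
  ~~ (extend0 (letter w) i < extend0 (letter w) j) = (extend0 (letter w) j < extend0 (letter w) i).
Proof.
move=> ltin ltjn ij; rewrite (extend0_ord _ ltin) (extend0_ord _ ltjn) -leNgt lt_neqAle.
by rewrite (inj_eq (@letter_inj _ w)) -val_eqE /= eq_sym ij.
Qed.

(** On the left-hand side the step from index 2j is left open.  If it is an ascent,
    the increasing part starts one letter earlier; if it is a descent, the snake
    goes on, also through the next step, if any, which is an ascent both in a snake
    and in an increasing word. *)
Lemma partial_snake_step n j : (0 < j)%N -> (j.*2.+1 < n)%N ->
  snake_coef j.*2.+1 / ratq_of (qfact (n - j.*2.+1))
  = Dfreq (@partial_snake n j) + Dfreq (@partial_snake n j.+1).
Proof.
move=> j0 jn; have [m nE] : {m | n = (j.*2.+1 + m)%N}.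
  by exists (n - j.*2.+1)%N; rewrite subnKC // ltnW.
rewrite {n}nE in jn *; rewrite addKn snake_coefE.
rewrite -(Dfreq_blocks _ (@snake_word_invariant _)).
rewrite (Dfreq_split _ (fun f => extend0 f j.*2 < extend0 f j.*2.+1)).
have blocksE (f : 'I_(j.*2.+1 + m) -> int) :
    snake_word (left_word f) && increasing (right_word f)
    = [&& extend0 f 0 < - extend0 f 1, zigzag (extend0 f) 0 j.*2
        & rising (extend0 f) j.*2.+1 (j.*2 + m)].
  rewrite snake_wordE; last by lia.
  rewrite !extend0_left; [|lia..]; rewrite -andbA; congr [&& _, _ & _].
    apply: eq_in_all => i; rewrite mem_index_iota /= => ij.
    by rewrite !extend0_left //; lia.
  by rewrite increasing_right; congr (rising _ _ _); lia.
congr (_ + _); apply: eq_Dfreq => w; rewrite blocksE /partial_snake;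
  rewrite -[(j.*2.+1 + m).-1]/(j.*2 + m)%N.
  rewrite (minn_idPl _) ?leq_addr // (@rising_cons _ j.*2); last by lia.
  by rewrite -!andbA; congr [&& _, _ & _]; rewrite andbC.
rewrite letter_nltE ?(ltnW jn) //; last by lia.
move: (extend0 (letter w)) => g; have [->|m1] := eqVneq m 1%N.
  rewrite (minn_idPr _) ?addn1 ?doubleS // !rising_nil ?doubleS // !andbT.
  by rewrite zigzag_rcons //= odd_double -andbA.
rewrite (minn_idPl _); last by rewrite doubleS; lia.
rewrite doubleS !zigzag_rcons //= odd_double /= (@rising_cons _ j.*2.+1); last by lia.
by rewrite -!andbA; congr [&& _, _ & _]; rewrite andbA andbC.
Qed.

Lemma oneD n : 1%g \in groupD n.
Proof.
rewrite groupDE group1 (_ : [set i | _] = set0) ?cards0 //.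
by apply/setP => i; rewrite !inE /letter perm1 /sidx_val /= mul1r.
Qed.

Lemma invD1 n : invD (1 : {perm sidx n}) = 0%N.
Proof.
have letter1 i : letter (1 : {perm sidx n}) i = i.+1%:Z.
  by rewrite /letter perm1 /sidx_val /= mul1r.
rewrite invDE /inv_word /nsp_word !big1 // => i _; apply: big1 => j ij;
  rewrite !letter1; lia.
Qed.

(** These words have no descent at all, and the identity is the only one of them
    in the even-signed group. *)
Definition dominant n (f : 'I_n -> int) :=
  rising (extend0 f) 0 n.-1 && ~~ (extend0 f 0 < - extend0 f 1).

(** Without descents the absolute values increase, so they are 1, ..., n; all
    letters after the first are positive, and the parity of the number of signs
    decides the first one. *)
Lemma dominant1 n (w : {perm sidx n}) : (1 < n)%N ->
  w \in groupD n -> dominant (letter w) -> w = 1%g.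
Proof.
case: n w => [|[|n]] // w _; rewrite groupDE => /andP[Bw even_neg] /andP[].
rewrite -increasingE => incr.
have lt_letter (i j : 'I_n.+2) : (i < j)%N -> letter w i < letter w j.
  by move: incr => /forallP/(_ i)/forallP/(_ j)/implyP.
pose s := perm (abs_letter_inj Bw).
have letterE i : letter w i = (-1) ^+ (w (false, i)).1 * (s i).+1%:Z by rewrite permE.
have lt1n : (1 < n.+2)%N by [].
rewrite (extend0_ord _ (ltn0Sn _)) (extend0_ord _ lt1n).
set i0 := Ordinal _; set i1 := Ordinal lt1n => pos01.
have i1_min (j : 'I_n.+2) : j != i0 -> letter w i1 <= letter w j.
  case: (ltngtP 1%N j) => [/(lt_letter i1)/ltW // | |eq1].
    by rewrite ltnS leqn0 => /eqP j0 /eqP[]; apply: val_inj.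
  by rewrite (_ : j = i1) //; apply: val_inj.
have lt01 := lt_letter i0 i1 isT.
have s01 : s i0 != s i1 :> nat by rewrite (inj_eq val_inj) (inj_eq perm_inj).
have sgnE j : (w (false, j)).1 = (letter w j < 0).
  by rewrite letterE; case: (_.1); rewrite ?expr0 ?expr1; lia.
have pos j : j != i0 -> (w (false, j)).1 = false.
  by move=> /i1_min; rewrite sgnE; lia.
have s1 : s = 1%g.
  apply: increasing_perm => i j ij.
  have j0 : j != i0 by rewrite -val_eqE /=; lia.
  have posE k : k != i0 -> letter w k = (s k).+1%:Z.
    by move=> /pos wk; rewrite letterE wk mul1r.
  have := lt_letter i j ij; rewrite (posE j) //.
  have [->|/posE->] := eqVneq i i0; last by rewrite ltz_nat ltnS.
  move: s01 pos01 lt01 (i1_min j j0); rewrite (posE i1) // (posE j) // letterE.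
  move: (s i0 : nat) (s i1 : nat) (s j : nat) => a b c.
  by case: (w (false, i0)).1; rewrite ?expr0 ?expr1; lia.
have pos0 : (w (false, i0)).1 = false.
  move: even_neg; rewrite odd_card (bigD1 i0) //= big1 ?addbF => [|j /pos]; last by rewrite sgnE.
  by rewrite sgnE => /negPf.
have wE j : w (false, j) = (false, j).
  rewrite [LHS]surjective_pairing; congr (_, _).
    by have [->|/pos] := eqVneq j i0.
  by have := permE (abs_letter_inj Bw) j; rewrite -/s s1 perm1.
apply/permP => -[[] j]; rewrite perm1 // -[(true, j)]/(sidx_opp (false, j)).
by rewrite (groupBP _ Bw) wE.
Qed.

Lemma Dfreq_dominant n : (1 < n)%N ->
  Dfreq (@dominant n) = (ratq_of (polyD1 n))^-1.
Proof.
move=> n1; rewrite /Dfreq -[RHS]mul1r -ratq_of1; congr (ratq_of _ / _).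
rewrite /Dsum (bigD1 1%g) ?oneD //= big1 => [|w /andP[Dw w1]]; last first.
  case dom_w: (dominant _); last by rewrite mul0r.
  by rewrite (dominant1 n1 Dw dom_w) eqxx in w1.
rewrite invD1 addr0 mulr1 (_ : dominant _) // /dominant.
have letter1 i (lti : (i < n)%N) : extend0 (letter (1 : {perm sidx n})) i = i.+1%:Z.
  by rewrite extend0_ord /letter perm1 /sidx_val /= mul1r.
rewrite !letter1 ?(ltnW n1) // andbT.
by apply/allP => i; rewrite mem_index_iota /= => lti; rewrite !letter1; lia.
Qed.

Lemma Dfreq_rising k m :
  Dfreq (fun f : 'I_(k + m) -> int => rising (extend0 f) k (k + m.-1))
  = (ratq_of (qfact m))^-1.
Proof.
have := @Dfreq_blocks k m (fun=> true) (fun _ _ _ => erefl).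
rewrite Dfreq_true mul1r => <-; apply: eq_Dfreq => w.
by rewrite increasing_right.
Qed.

Lemma letter_neq_opp n (w : {perm sidx n}) i j :
  w \in groupB n -> i != j -> letter w i != - letter w j.
Proof.
move=> /groupBP odd_w; apply: contra_neq; rewrite /letter -sidx_valN -odd_w.
by move=> /sidx_val_inj/perm_inj[].
Qed.

(** Reversing the sign of the first letter exchanges the conditions
    w_1 < w_2 and -w_2 < w_1, the two extreme nodes of the Dynkin diagram. *)
Lemma Dfreq_rising_neg n :
  Dfreq (fun f : 'I_n.+2 -> int => rising (extend0 f) 1 n.+1 && ~~ (extend0 f 0 < - extend0 f 1))
  = (ratq_of (qfact n.+2))^-1.
Proof.
rewrite -(@Dfreq_rising 0 n.+2) /Dfreq; congr (ratq_of _ / _).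
have rise_inv : order_invariant (fun f : 'I_n.+2 -> int => rising (extend0 f) 0 n.+1).
  move=> f g fg; rewrite -!(@increasingE n.+2).
  exact/increasing_pattern/same_order_pattern.
have neg_inv : order_invariant (fun f : 'I_n.+2 -> int =>
    rising (extend0 f) 1 n.+1 && ~~ (extend0 f 0 < - extend0 f 1)).
  move=> f g fg; congr (_ && ~~ _); last first.
    rewrite !(extend0_ord _ (ltn0Sn _)) !(extend0_ord _ (isT : 1 < n.+2)%N).
    by have [] := fg (Ordinal (ltn0Sn _)) (Ordinal (isT : 1 < n.+2)%N).
  rewrite -!(@increasing_right 1 n.+1).
  apply/increasing_pattern/same_order_pattern => i j ij; apply: fg.
  exact: contra_neq (@rshift_inj 1 n.+1 i j) ij.
have two0 : (2 : {poly int}) != 0 by rewrite -polyC_natr polyC_eq0.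
apply: (mulfI two0); rewrite -(Bsum_Dsum neg_inv) -(Bsum_Dsum rise_inv).
rewrite -[RHS]Bsum_flip_first; apply: eq_bigr => w Bw; congr (_%:R * _).
congr nat_of_bool; rewrite [RHS]rising_cons // andbC; congr (_ && _).
  rewrite !(extend0_ord _ (ltn0Sn _)) !(extend0_ord _ (isT : 1 < n.+2)%N) /flip_first /=.
  rewrite -leNgt ltrNl lt_neqAle; set i0 := Ordinal _; set i1 := Ordinal _.
  by rewrite eq_sym letter_neq_opp.
apply: eq_rising => i /andP[i0 lti]; rewrite !(extend0_ord _ (lti : (i < n.+2)%N)).
by rewrite /flip_first -val_eqE /= gtn_eqF.
Qed.

(** Inclusion-exclusion on the two ascents that the start of a snake forbids. *)
Lemma partial_snake_first n : (1 < n)%N ->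
  Dfreq (@partial_snake n 1) = (ratq_of (qfact n.-1))^-1
    - 2 * (ratq_of (qfact n))^-1 + (ratq_of (polyD1 n))^-1.
Proof.
case: n => [|[|n]] // _.
pose T (f : 'I_n.+2 -> int) := rising (extend0 f) 1 n.+1.
pose neg (f : 'I_n.+2 -> int) := extend0 f 0 < - extend0 f 1.
pose asc (f : 'I_n.+2 -> int) := extend0 f 0 < extend0 f 1.
have T_asc : Dfreq (fun f => T f && asc f) = (ratq_of (qfact n.+2))^-1.
  rewrite -(Dfreq_rising 0 n.+2); apply: eq_Dfreq => w.
  by rewrite rising_cons // andbC.
have := Dfreq_split T asc; rewrite T_asc (Dfreq_rising 1 n.+1) => T_split.
have := Dfreq_split (fun f => T f && ~~ asc f) neg => T_desc_split.
have := Dfreq_split (fun f => T f && ~~ neg f) asc.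
rewrite Dfreq_rising_neg => T_pos_split.
have dom : Dfreq (fun f => (T f && ~~ neg f) && asc f) = (ratq_of (polyD1 n.+2))^-1.
  rewrite -Dfreq_dominant //; apply: eq_Dfreq => w.
  by rewrite /dominant rising_cons // andbC andbA.
have swap : Dfreq (fun f => (T f && ~~ neg f) && ~~ asc f)
    = Dfreq (fun f => (T f && ~~ asc f) && ~~ neg f).
  by apply: eq_Dfreq => w; rewrite -!andbA [~~ _ && _]andbC.
have -> : Dfreq (@partial_snake n.+2 1) = Dfreq (fun f => (T f && ~~ asc f) && neg f).
  apply: eq_Dfreq => w; rewrite /partial_snake letter_nltE // [RHS]andbC.
  congr (_ && _); rewrite /T.
  case: n {T neg asc T_asc T_split T_desc_split T_pos_split dom swap} w => [|n] w.
    by rewrite !rising_nil // andbT (zigzag_rcons _ (leqnn 0)).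
  rewrite (minn_idPl _) // !zigzag_rcons //= [rising _ 1 _]rising_cons //.
  by rewrite -andbA andbC -andbA; case: (_ < _); case: (_ < _); rewrite ?andbF ?andbT.
rewrite dom swap in T_pos_split.
move: T_split T_pos_split; rewrite T_desc_split /=.
set e1 := _^-1; set e2 := _^-1; set d := _^-1 => -> ->.
ring.
Qed.

(** * Generating functions *)

Lemma fpsCM (R : comUnitRingType) (a b : R) : fpsC (a * b) = fpsC a * fpsC b.
Proof. by apply/fpsP => n; rewrite fcoefCM /=; case: eqP; rewrite ?mulr0. Qed.

Lemma fcoef_divC (F : fieldType) (f : fps F) (c : F) n :
  c != 0 -> fcoef (f / fpsC c) n = fcoef f n / c.
Proof.
move=> c0; have Uc : fpsC c \is a GRing.unit by rewrite fps_unitE [fcoef _ _]/= unitfE.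
have -> : f / fpsC c = fpsC c^-1 * f.
  by apply: (mulIr Uc); rewrite divrK // mulrAC -fpsCM mulVf // mul1r.
by rewrite fcoefCM mulrC.
Qed.

Lemma fcoefXM (R : comUnitRingType) (f : fps R) n : fcoef (fpsX R * f) n.+1 = fcoef f n.
Proof.
rewrite fcoefM 2!big_ord_recl /= mul0r add0r mul1r subn1 big1 ?addr0 // => i _.
by rewrite mul0r.
Qed.

Lemma exp_imaginary (F : fieldType) (x : F) n : x ^+ 2 = -1 ->
  x ^+ n = (if odd n then x else 1) * (-1) ^+ n./2.
Proof.
move=> x2; rewrite -{1}[n]odd_double_half exprD -mul2n exprM x2.
by case: (odd n); rewrite ?expr1.
Qed.

Lemma even_part (F : fieldType) (x y : F) n : x ^+ 2 = -1 -> (2 : F) != 0 ->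
  (x ^+ n * y + (- x) ^+ n * y) / 2 = if odd n then 0 else (-1) ^+ n./2 * y.
Proof.
move=> x2 two0; rewrite (exprNn x) -(signr_odd _ n) (exp_imaginary n x2).
by move: (_ ^+ n./2) => s; case: (odd n); rewrite ?expr0 ?expr1; field.
Qed.

Lemma odd_part (F : fieldType) (x y : F) n : x ^+ 2 = -1 -> (2 : F) != 0 ->
  (x ^+ n * y - (- x) ^+ n * y) / (2 * x) = if odd n then (-1) ^+ n./2 * y else 0.
Proof.
move=> x2 two0; have x0 : x != 0.
  by apply: contra_eq_neq x2 => ->; rewrite expr0n eq_sym oppr_eq0 oner_eq0.
rewrite (exprNn x) -(signr_odd _ n) (exp_imaginary n x2).
by move: (_ ^+ n./2) => s; case: (odd n); rewrite ?expr0 ?expr1; field; rewrite x0.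
Qed.

Lemma iq2 : iq ^+ 2 = -1.
Proof. by rewrite /iq -rmorphXn -polyC_exp sqrCi polyCN rmorphN polyC1 rmorph1. Qed.

Lemma fcoef_cos E n :
  fcoef (fps_cos E) n = if odd n then 0 else (-1) ^+ n./2 * fcoef E n.
Proof.
rewrite /fps_cos (_ : 2 = fpsC 2); last exact: (fps_natE _ 2).
rewrite fcoef_divC ?two_neq0 // fcoefD.
exact: (even_part (fcoef E n) n iq2 two_neq0).
Qed.

Lemma fcoef_sin E n :
  fcoef (fps_sin E) n = if odd n then (-1) ^+ n./2 * fcoef E n else 0.
Proof.
have two_iq0 : 2 * iq != 0 by have := two_iq_unit; rewrite fps_unitE [fcoef _ _]/= unitfE.
rewrite /fps_sin fcoef_divC // fcoefD fcoefN.
exact: (odd_part (fcoef E n) n iq2 two_neq0).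
Qed.

(** This solves the recursion [partial_snake_step] for z N. *)
Lemma alternating_telescope (R : nzRingType) (z : nat -> R) N : (0 < N)%N ->
  \sum_(1 <= j < N) (-1) ^+ (N - j) * (z j + z j.+1) = (-1) ^+ N.-1 * z 1%N - z N.
Proof.
case: N => // N _; elim: N => [|N IHN]; first by rewrite big_geq // mul1r subrr.
rewrite big_nat_recr //= subSn // subnn expr1 mulN1r.
rewrite (eq_big_nat _ _ (F2 := fun j => - ((-1) ^+ (N.+1 - j) * (z j + z j.+1)))); last first.
  by move=> j /andP[_ jN]; rewrite subSn 1?ltnW // exprS mulN1r mulNr.
by rewrite sumrN IHN /= opprB opprD addrA [z _ - _ - z _]addrAC subrr add0r exprS mulN1r mulNr.
Qed.

Lemma sum_odd_indices (V : nmodType) (F : nat -> V) N : (forall j, F j.*2 = 0) ->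
  \sum_(i < N.*2) F i = \sum_(0 <= j < N) F j.*2.+1.
Proof.
move=> F0; elim: N => [|N IHN]; first by rewrite big_ord0 big_nil.
by rewrite doubleS !big_ord_recr /= IHN F0 addr0 big_nat_recr.
Qed.

Lemma qfact_small n : (n <= 1)%N -> (ratq_of (qfact n))^-1 = 1.
Proof.
case: n => [|[|]] // _; rewrite /qfact ?big_nil ?big_nat1 ?ratq_of1 ?invr1 //.
by rewrite /qint big_ord1 expr0 ratq_of1 invr1.
Qed.

Lemma polyD1_small n : (n <= 1)%N -> (ratq_of (polyD1 n))^-1 = 1.
Proof.
move=> n1; rewrite /polyD1 (bigD1 1%g) ?oneD //= invD1 big1 ?addr0 ?ratq_of1 ?invr1 //.
move=> w /andP[Dw]; case/eqP.
case: n n1 w Dw => [|[|n]] // _ w; first by move=> _; apply/permP => -[? []].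
rewrite groupDE => /andP[Bw]; rewrite odd_card big_ord1 => pos0.
have w0 : w (false, ord0) = (false, ord0).
  move: pos0; rewrite /letter /sidx_val; case: (w _) => -[] i; rewrite [i]ord1 //=.
apply/permP => -[b i]; rewrite [i]ord1 perm1; case: b => //.
by rewrite -[(true, _)]/(sidx_opp (false, ord0)) (groupBP _ Bw) w0.
Qed.

Lemma odd_snake_cos_term n i :
  fcoef odd_snake_series i * fcoef cos_q (n - i)
  = if odd i && (2 < i)%N && ~~ odd (n - i)
    then (-1) ^+ (n - i)./2 * (snake_coef i / ratq_of (qfact (n - i))) else 0.
Proof.
rewrite fcoef_cos [fcoef odd_snake_series _]/=.
case: (odd i); case: (2 < i)%N; rewrite ?mul0r //=.
by case: (odd _); rewrite ?mulr0 //= mulrCA.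
Qed.

(** For n = 2N + 1 the term j = N of the coefficient is S_n/D_n = z_N itself, and it
    cancels the end of the telescoping sum. *)
Lemma odd_snake_seriesE :
  odd_snake_series * cos_q = 2 * sin_q - fpsX ratq * cos_q - sin_D.
Proof.
apply/fpsP => n; rewrite fcoefM; under eq_bigr do rewrite odd_snake_cos_term.
rewrite !fcoefD !fcoefN mulr_natl mulr2n fcoefD !fcoef_sin.
have [odd_n|even_n] := boolP (odd n); last first.
  rewrite big1 => [|i _]; last first.
    case: ifP => // /andP[/andP[odd_i _]].
    by rewrite oddB ?odd_i ?(negPf even_n) // -ltnS.
  case: n even_n => [|n] even_n; rewrite ?fcoefXM ?fcoef_cos.
    by rewrite fcoefM big_ord1 mul0r !subr0 addr0.
  by rewrite /= negbK in even_n; rewrite even_n !subr0 addr0.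
have [N ->] : exists N, n = N.*2.+1.
  by exists n./2; rewrite -[LHS]odd_double_half odd_n.
rewrite fcoefXM fcoef_cos /= odd_double /= uphalf_double doubleK.
pose F i := if odd i && (2 < i)%N && ~~ odd (N.*2.+1 - i)
  then (-1) ^+ (N.*2.+1 - i)./2 * (snake_coef i / ratq_of (qfact (N.*2.+1 - i))) else 0.
rewrite -[N.*2.+2]doubleS (sum_odd_indices (F := F)) => [|j]; last first.
  by rewrite /F odd_double.
case: N @F => [|N] F.
  by rewrite big_nat1 !expr0 !mul1r /exp_D /e_q /= !qfact_small ?polyD1_small // addrK subrr.
pose z := fun j => Dfreq (@partial_snake N.+1.*2.+1 j).
rewrite big_ltn // [F _]/= add0r big_nat_recr //=.
rewrite (eq_big_nat _ _ (F2 := fun j => (-1) ^+ (N.+1 - j) * (z j + z j.+1))); last first.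
  move=> j /andP[j0 jN]; rewrite /F /= odd_double subSS -doubleB odd_double.
  rewrite doubleK ltnS -(doubleS 0) leq_double j0 /=; congr (_ * _).
  rewrite -partial_snake_step //; last by lia.
  by rewrite subSS -doubleB.
rewrite alternating_telescope // /F subnn /= odd_double expr0 mul1r qfact_small // mulr1.
have -> : z N.+1 = snake_coef N.+1.*2.+1 by apply: partial_snake_last.
rewrite subrK /z partial_snake_first //= exprS.
move: ((-1) ^+ N : ratq) (ratq_of (qfact _))^-1 (ratq_of (qfact _))^-1 (ratq_of (polyD1 _))^-1.
by move=> s e e' d; ring.
Qed.

Lemma odd_snake_sin_term n i :
  fcoef odd_snake_series i * fcoef sin_q (n - i)
  = if odd i && (2 < i)%N && odd (n - i)
    then (-1) ^+ (n - i)./2 * (snake_coef i / ratq_of (qfact (n - i))) else 0.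
Proof.
rewrite fcoef_sin [fcoef odd_snake_series _]/=.
case: (odd i); case: (2 < i)%N; rewrite ?mul0r //=.
by case: (odd _); rewrite ?mulr0 //= mulrCA.
Qed.

(** For n = 2N the telescoping sum stops at j = N - 1 and its end z_N = S_n/D_n is the
    coefficient of the even series. *)
Lemma even_snake_seriesE :
  even_snake_series
  = odd_snake_series * sin_q + fpsX ratq * sin_q + 2 * cos_q - cos_D - 1.
Proof.
have coefE (R : comUnitRingType) (a b c d : fps R) n : fcoef (a + b + 2 * c - d - 1) n
    = fcoef a n + fcoef b n + (fcoef c n + fcoef c n) - fcoef d n - (n == 0%N)%:R.
  by rewrite mulr_natl mulr2n !fcoefD !fcoefN /=; case: (n == 0%N).
apply/fpsP => n; transitivity (if (2 <= n)%N && ~~ odd n then snake_coef n else 0) => //.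
rewrite [RHS](coefE _ (odd_snake_series * sin_q) (fpsX ratq * sin_q) cos_q cos_D).
rewrite fcoefM; under eq_bigr do rewrite odd_snake_sin_term.
rewrite !fcoef_cos.
have [odd_n|even_n] := boolP (odd n).
  rewrite big1 => [|i _]; last first.
    case: ifP => // /andP[/andP[odd_i _]].
    by rewrite oddB ?odd_i ?odd_n // -ltnS.
  case: n odd_n => [|n] // odd_n; rewrite fcoefXM fcoef_sin (negPf (odd_n : ~~ odd n)).
  by rewrite andbF !addr0 !subr0.
have [N ->] : exists N, n = N.*2.
  by exists n./2; rewrite -[LHS]odd_double_half (negPf even_n).
rewrite doubleK.
case: N => [|N].
  rewrite big_ord1 fcoefM big_ord1 [fcoef (fpsX _) _]/= mul0r !expr0 !mul1r /exp_D /e_q /=.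
  by rewrite !qfact_small ?polyD1_small // !add0r addrK subrr.
rewrite doubleS fcoefXM fcoef_sin. rewrite /= odd_double /= uphalf_double subr0.
pose F i := if odd i && (2 < i)%N && odd (N.*2.+2 - i)
  then (-1) ^+ (N.*2.+2 - i)./2 * (snake_coef i / ratq_of (qfact (N.*2.+2 - i))) else 0.
rewrite big_ord_recr /= odd_double /= addr0.
rewrite -[N.*2.+2]doubleS (sum_odd_indices (F := F)) => [|j]; last first.
  by rewrite /F odd_double.
pose z := fun j => Dfreq (@partial_snake N.+1.*2 j).
rewrite big_ltn // [F _]/= add0r.
rewrite (eq_big_nat _ _ (F2 := fun j => - ((-1) ^+ (N.+1 - j) * (z j + z j.+1)))); last first.
  move=> j /andP[j0 jN].
  have -> : F j.*2.+1 = (-1) ^+ (N - j)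
      * (snake_coef j.*2.+1 / ratq_of (qfact (N.*2.+2 - j.*2.+1))).
    have jE : (N.*2.+2 - j.*2.+1 = (N - j).*2.+1)%N by lia.
    by rewrite /F /= jE /= !odd_double /= uphalf_double ltnS -(doubleS 0) leq_double j0.
  rewrite -doubleS partial_snake_step //; last by lia.
  by rewrite subSn -1?ltnS // exprS mulN1r mulNr opprK.
rewrite sumrN alternating_telescope //=.
have -> : z N.+1 = snake_coef N.+1.*2 by apply: partial_snake_last; rewrite // leq_pred.
rewrite /z partial_snake_first //= exprS.
move: ((-1) ^+ N : ratq) (snake_coef _).
move: (ratq_of (qfact _))^-1 (ratq_of (qfact _))^-1 (ratq_of (polyD1 _))^-1.
by move=> e e' d s a; ring.
Qed.

Lemma divr_numerators (R : comUnitRingType) (c s cD sD x odd even : R) :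
    c \is a GRing.unit ->
    odd * c = 2 * s - x * c - sD ->
    even = odd * s + x * s + 2 * c - cD - 1 ->
  even = (- 2 * c ^+ 2 + c * (cD + 1) - 2 * s ^+ 2 + s * sD) / (- c)
  /\ odd = (- 2 * s + x * c + sD) / (- c).
Proof.
move=> Uc oddE evenE; have UNc : - c \is a GRing.unit by rewrite unitrN.
split; apply: (mulIr UNc); rewrite divrK //.
  have -> : even * - c = - (odd * c * s + (x * s + 2 * c - cD - 1) * c).
    by rewrite evenE; ring.
  by rewrite oddE; ring.
by rewrite mulrN oddE; ring.
Qed.

(* The constant term in the first numerator is 1, not -1, next to cos_D: the  *)
(* left-hand side has no term in u^0, so the numerator must vanish at u = 0.  *)
Theorem corollary40 :
  even_snake_series
    = (- 2 * cos_q ^+ 2 + cos_q * (cos_D + 1) - 2 * sin_q ^+ 2 + sin_q * sin_D)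
      / (- cos_q)
  /\
  odd_snake_series
    = (- 2 * sin_q + fpsX ratq * cos_q + sin_D) / (- cos_q).
Proof.
exact: divr_numerators cos_q_unit odd_snake_seriesE even_snake_seriesE.
Qed.
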